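(* Let $q\neq0$ be a Herglotz function. If $\operatorname{Im}q(ir)=o(|q(ir)|)$ as $r\to\infty$, then, for every $\delta\in[0,1)$, $$\lim_{r\to\infty}\frac{q\Bigl(ir\Bigl[\frac{\operatorname{Im}q(ir)}{|q(ir)|}\Bigr]^\delta\Bigr)}{q(ir)}=1.$$ For every $k>0$, we also have $\lim_{r\to\infty}\frac{q(ikr)}{q(ir)}=1$; in particular, $|q(ir)|$ is slowly varying at infinity.
   Context: A Herglotz function is a holomorphic function $q$ on $\mathbb C\setminus\mathbb R$ with $\frac{\operatorname{Im}q(z)}{\operatorname{Im}z}\ge0$ and $q(\overline z)=\overline{q(z)}$ for all $z\in\mathbb C\setminus\mathbb R$. A measurable function $f:(0,\infty)\to(0,\infty)$ is slowly varying (at infinity) if $\lim_{r\to\infty}\frac{f(\lambda r)}{f(r)}=1$ for every $\lambda>0$. $f=o(g)$ means $f/g\to0$. In the degenerate case that $q$ is a nonzero real constant (so that $\operatorname{Im}q(ir)=0$ and the argument of $q$ in the numerator of the first display may be $0$), $q$ is understood as a constant function also at the point $0$. *)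

(* Defs.v *)
From HB Require Import structures.
From mathcomp Require Import all_boot all_order all_algebra.
From mathcomp Require Import all_classical all_reals all_analysis.
From mathcomp Require Import complex.

Set Implicit Arguments.
Unset Strict Implicit.
Unset Printing Implicit Defensive.

Import Order.TTheory GRing.Theory Num.Theory.
Import numFieldNormedType.Exports.

Local Open Scope classical_set_scope.
Local Open Scope complex_scope.
Local Open Scope ring_scope.

(* The domain C \ R. A function on C \ R is encoded as a total function
   R[i] -> R[i] whose values elsewhere are unconstrained. *)
Definition offaxis (R : realType) : set R[i] := [set z | complex.Im z != 0].

(* Complex differentiability at each point of D: with scalar field R[i], the
   limit of the difference quotient in [derivable _ z 1] ranges over all complex
   increments h -> 0. *)
Definition holomorphic_on (R : realType) (D : set R[i]) (q : R[i] -> R[i]) :=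
  forall z : R[i], D z -> derivable (q : R[i]^o -> R[i]^o) (z : R[i]^o) 1.

Definition herglotz (R : realType) (q : R[i] -> R[i]) : Prop :=
  [/\ holomorphic_on (@offaxis R) q,
      forall z, offaxis z -> 0 <= complex.Im (q z) / complex.Im z &
      forall z, offaxis z -> q (conjc z) = conjc (q z) ].

(* [q] itself, except that when [q] is a real constant on C \ R that constant
   is also the value at the point 0. *)
Definition const_ext0 (R : realType) (q : R[i] -> R[i]) (z : R[i]) : R[i] :=
  if `[< z = 0 /\ exists c : R, forall w, offaxis w -> q w = c%:C >]
  then q (0 +i* 1) else q z.

(* The norm `|z| of R[i] is itself valued in R[i]; this is the modulus in R. *)
Notation cmod := ComplexField.Normc.normc.

(* [f] is a function on (0, +oo); its values elsewhere are irrelevant. *)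
Definition slowly_varying (R : realType) (f : R -> R) : Prop :=
  [/\ measurable_fun [set r : R | 0 < r] f,
      forall r, 0 < r -> 0 < f r &
      forall lam, 0 < lam -> f (lam * r) / f r @[r --> +oo] --> (1 : R)].

(* Main.v *)
Require Import Defs.
From HB Require Import structures.
From mathcomp Require Import all_boot all_order all_algebra.
From mathcomp Require Import all_classical all_reals all_analysis.
From mathcomp Require Import complex.
From mathcomp Require Import measurable_realfun.
From mathcomp Require Import ring lra.
Set Implicit Arguments.
Unset Strict Implicit.
Unset Printing Implicit Defensive.
Import Order.TTheory GRing.Theory Num.Theory.
Import numFieldNormedType.Exports.
Local Open Scope classical_set_scope.
Local Open Scope complex_scope.
Local Open Scope ring_scope.

(** Put p(r) = q(ir), v = Im p and eps = v / |p|. The proof rests on the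
    Schwarz-Pick inequality |q'(z)| <= Im q(z) / Im z in the upper half-plane
    ([schwarz_pick]). On the imaginary axis it says |p'(t)| <= v(t) / t. For v
    itself this is Harnack's inequality: t v(t) is nondecreasing and v(t) / t is
    nonincreasing. Integrating the bound on p' from s to r >= s then shows that
    Re p and Im p change by at most v(r) (r/s - 1) ([ray_down]), and
    symmetrically for s >= r ([ray_up]). Hence
      |p(s) / p(r) - 1| <= 2 eps(r) (r/s - 1)   for s <= r.
    For s = k r the right-hand side is a constant times eps(r), and for
    s = r eps(r)^delta it is at most 2 eps(r)^(1 - delta); both tend to 0.
    Every delta < 1 is reached because r/s occurs with exponent 1, and that in
    turn needs Schwarz-Pick with its sharp constant. If v vanishes at one point,
    Schwarz-Pick and Gronwall's inequality along segments make q a real constant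
    ([constant_of_Im_eq0]), and the ratios are identically 1.

    Moved to the unit disc by a Cayley map, Schwarz-Pick becomes the coefficient
    bound |h'(0)| <= 2 Im h(0) for holomorphic h with Im h >= 0
    ([borel_caratheodory]). There one wants to integrate Im h against the
    nonnegative weight 2 + 2 Re(b z) over the circle |z| = 1/|b|; [tilt] is a
    function holomorphic off 0 whose imaginary part is that integrand on the
    circle, and whose limit at 0 is 2 h(0) + h'(0)/b.

    The mean of Im g over |z| = r is the same for all r if g is holomorphic in
    the punctured disc ([equal_Im_on_circles]): in the coordinates z = exp(s +
    it), Im g dt - Re g ds is a closed form, 2 pi-periodic in t. As the
    derivative of g is not known to be continuous, closedness is a pointwise
    statement, and the vanishing of the circulation around a rectangle is
    Goursat's theorem ([goursat]), proved by bisection. *)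

(** * Mean values on the real line *)

Lemma derive_continuous (R : realType) (f : R -> R) (x df : R) :
  is_derive x 1 f df -> {for x, continuous f}.
Proof. by case=> df1 _; apply/differentiable_continuous/derivable1_diffP. Qed.

Lemma within_continuousW (R : realType) (f : R -> R) (a b : R) :
  (forall x, a <= x <= b -> {for x, continuous f}) ->
  {within `[a, b], continuous f}.
Proof.
move=> fc; apply: continuous_in_subspaceT => x.
by rewrite inE /= in_itv /= => /fc.
Qed.

Lemma mean_value (R : realType) (f df : R -> R) (a b : R) : a <= b ->
  (forall x, a <= x <= b -> is_derive x 1 f (df x)) ->
  exists2 c, a <= c <= b & f b - f a = df c * (b - a).
Proof.
move=> ab fdf; have [||c] := @MVT_segment R f df a b ab.
- by move=> x; rewrite in_itv /= => /andP[ax xb]; apply: fdf; rewrite !ltW.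
- by apply: within_continuousW => x /fdf /derive_continuous.
- by rewrite in_itv /= => cab fE; exists c.
Qed.

(** The elementary estimate of Goursat's argument: if the integrand is within e
    of an affine function, centred at the point t where the form is
    differentiated, the integral is within e (b - a) of that of the affine
    function. *)
Lemma primitive_affine (R : realType) (F f : R -> R) (a b t al be e : R) :
  a <= b -> (forall x, a <= x <= b -> is_derive x 1 F (f x)) ->
  (forall x, a <= x <= b -> `|f x - (al + be * (x - t))| <= e) ->
  `|F b - F a - (al * (b - a) + be * ((b - t) ^+ 2 - (a - t) ^+ 2) / 2)|
    <= e * (b - a).
Proof.
move=> ab dF fe.
pose G x := F x - (al * x + be * (x - t) ^+ 2 / 2).
have dG x : a <= x <= b -> is_derive x 1 G (f x - (al + be * (x - t))).
  move=> xab; have ? := dF x xab; rewrite /G.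
  apply: is_derive_eq; by rewrite /GRing.scale /=; field.
have [c cab] := mean_value ab dG.
rewrite /G => Gc.
have -> : F b - F a - (al * (b - a) + be * ((b - t) ^+ 2 - (a - t) ^+ 2) / 2) =
   (f c - (al + be * (c - t))) * (b - a) by rewrite -Gc; field.
by rewrite normrM ler_pM// ?fe// ger0_norm ?subr_ge0.
Qed.

(** * Goursat's theorem for closed forms on a rectangle *)

(** Total differentiability at (x, y), with partial derivatives fx and fy. *)
Definition diff2 (R : realType) (f : R -> R -> R) (x y fx fy : R) :=
  forall e : R, 0 < e -> exists2 d : R, 0 < d &
    forall x' y', `|x' - x| <= d -> `|y' - y| <= d ->
      `|f x' y' - (f x y + fx * (x' - x) + fy * (y' - y))|
        <= e * (`|x' - x| + `|y' - y|).

(** The integral of P dx + Q dy around a rectangle, written with primitives F of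
    P along horizontal lines and G of Q along vertical lines: additivity under
    subdivision is then an algebraic identity. *)
Definition circulation (R : realType) (F G : R -> R -> R) (x y w h : R) : R :=
  (F (x + w) y - F x y) + (G (x + w) (y + h) - G (x + w) y)
  - (F (x + w) (y + h) - F x (y + h)) - (G x (y + h) - G x y).

Lemma circulation_split (R : realType) (F G : R -> R -> R) (x y w h : R) :
  circulation F G x y (w + w) (h + h) =
    circulation F G x y w h + circulation F G (x + w) y w h +
    (circulation F G x (y + h) w h + circulation F G (x + w) (y + h) w h).
Proof. by rewrite /circulation !addrA; ring. Qed.

Section Goursat.
Variables (R : realType) (P Q F G : R -> R -> R) (x0 y0 W H : R).
Let in_rect x y := x0 <= x <= x0 + W /\ y0 <= y <= y0 + H.
Hypotheses (W0 : 0 <= W) (H0 : 0 <= H).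
Hypothesis dF : forall x y, in_rect x y -> is_derive x 1 (F^~ y) (P x y).
Hypothesis dG : forall x y, in_rect x y -> is_derive y 1 (G x) (Q x y).
Hypothesis closed_form : forall x y, in_rect x y -> exists px m qy,
  diff2 P x y px m /\ diff2 Q x y m qy.

(* Up to first order the two contributions m w h of the mixed derivative, one
   from each pair of opposite sides, cancel. *)
Let circulation_local x y : in_rect x y -> forall e, 0 < e ->
  exists2 d, 0 < d & forall a b w h, 0 <= w <= d -> 0 <= h <= d ->
    x0 <= a -> a + w <= x0 + W -> y0 <= b -> b + h <= y0 + H ->
    a <= x <= a + w -> b <= y <= b + h ->
    `|circulation F G a b w h| <= e * (w + h) ^+ 2.
Proof.
move=> xy e e0; have [px [m [qy [dP dQ]]]] := closed_form xy.
have e20 : 0 < e / 2 by rewrite divr_gt0.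
have [d1 d10 P1] := dP _ e20; have [d2 d20 Q1] := dQ _ e20.
exists (Num.min d1 d2); first by rewrite lt_min d10.
move=> a b w h /andP[w0]; rewrite le_min => /andP[wd1 wd2] /andP[h0].
rewrite le_min => /andP[hd1 hd2] x0a awW y0b bhH /andP[ax xw] /andP[b_y yh].
have xin t : a <= t <= a + w -> x0 <= t <= x0 + W by move=> ?; lra.
have yin t : b <= t <= b + h -> y0 <= t <= y0 + H by move=> ?; lra.
have xd t : a <= t <= a + w -> `|t - x| <= w.
  by move=> ?; rewrite ler_norml; lra.
have yd t : b <= t <= b + h -> `|t - y| <= h.
  by move=> ?; rewrite ler_norml; lra.
have aw : a <= a + w by lra.
have bh : b <= b + h by lra.
have ba : a <= a <= a + w by rewrite lexx.
have bb : b <= b <= b + h by rewrite lexx.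
have ea : a <= a + w <= a + w by rewrite lexx andbT.
have eb : b <= b + h <= b + h by rewrite lexx andbT.
have horiz t : b <= t <= b + h ->
    `|F (a + w) t - F a t - ((P x y + m * (t - y)) * (a + w - a)
       + px * ((a + w - x) ^+ 2 - (a - x) ^+ 2) / 2)|
     <= e / 2 * (w + h) * (a + w - a).
  move=> tb; apply: (@primitive_affine _ (F^~ t) (P^~ t)) => //.
    by move=> s sa; apply: dF; split; [exact: xin|exact: yin].
  move=> s sa /=; have xs := xd _ sa; have yt := yd _ tb.
  rewrite (_ : P s t - (P x y + m * (t - y) + px * (s - x)) =
    P s t - (P x y + px * (s - x) + m * (t - y))); last by ring.
  apply: le_trans (P1 s t (le_trans xs wd1) (le_trans yt hd1)) _.
  by rewrite ler_pM2l// lerD.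
have vert s : a <= s <= a + w ->
    `|G s (b + h) - G s b - ((Q x y + m * (s - x)) * (b + h - b)
       + qy * ((b + h - y) ^+ 2 - (b - y) ^+ 2) / 2)|
     <= e / 2 * (w + h) * (b + h - b).
  move=> sa; apply: (@primitive_affine _ (G s) (Q s)) => //.
    by move=> t tb; apply: dG; split; [exact: xin|exact: yin].
  move=> t tb /=; have xs := xd _ sa; have yt := yd _ tb.
  apply: le_trans (Q1 s t (le_trans xs wd2) (le_trans yt hd2)) _.
  by rewrite ler_pM2l// lerD.
have h1 := vert _ ea; have h2 := vert _ ba.
have h3 := horiz _ eb; have h4 := horiz _ bb.
pose err t al be (u v : R) := v - (al * (t.2 - t.1)
  + be * ((t.2 - u) ^+ 2 - (t.1 - u) ^+ 2) / 2).
have -> : circulation F G a b w h =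
    err (a, a + w) (P x y + m * (b - y)) px x (F (a + w) b - F a b)
    + err (b, b + h) (Q x y + m * (a + w - x)) qy y
        (G (a + w) (b + h) - G (a + w) b)
    - err (a, a + w) (P x y + m * (b + h - y)) px x
        (F (a + w) (b + h) - F a (b + h))
    - err (b, b + h) (Q x y + m * (a - x)) qy y (G a (b + h) - G a b).
  by rewrite /circulation /err /=; field.
have tr (H1 H2 H3 H4 : R) :
    `|H4 + H1 - H3 - H2| <= `|H4| + `|H1| + `|H3| + `|H2|.
  by rewrite (le_trans (ler_normB _ _))// lerD2r (le_trans (ler_normB _ _))//
    lerD2r ler_normD.
apply: (le_trans (tr _ _ _ _)).
have -> : e * (w + h) ^+ 2 = e / 2 * (w + h) * (a + w - a)
  + e / 2 * (w + h) * (b + h - b) + e / 2 * (w + h) * (a + w - a)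
  + e / 2 * (w + h) * (b + h - b) by field.
by rewrite !lerD.
Qed.

Let w n : R := W / 2 ^+ n.
Let h n : R := H / 2 ^+ n.

Let halve (A : R) n : A / 2 ^+ n = A / 2 ^+ n.+1 + A / 2 ^+ n.+1.
Proof. by rewrite exprS; field; rewrite expf_neq0. Qed.

(* By additivity and the triangle inequality. *)
Let quarter n (p : R * R) : exists p' : R * R,
  [/\ p.1 <= p'.1, p'.1 + w n.+1 <= p.1 + w n, p.2 <= p'.2,
      p'.2 + h n.+1 <= p.2 + h n &
      `|circulation F G p.1 p.2 (w n) (h n)| <=
        4 * `|circulation F G p'.1 p'.2 (w n.+1) (h n.+1)| ].
Proof.
case: p => x y /=; rewrite /w /h (halve W n) (halve H n).
set w' := W / _; set h' := H / _.
have w0 : 0 <= w' by rewrite divr_ge0// exprn_ge0.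
have h0 : 0 <= h' by rewrite divr_ge0// exprn_ge0.
rewrite circulation_split.
set A := circulation _ _ _ _ _ _; set B := circulation _ _ _ _ _ _.
set C := circulation _ _ _ _ _ _; set D := circulation _ _ _ _ _ _.
have tr : `|A + B + (C + D)| <= `|A| + `|B| + (`|C| + `|D|).
  by rewrite (le_trans (ler_normD _ _))// lerD// ler_normD.
have [hA|hA] := leP `|A + B + (C + D)| (4 * `|A|).
  by exists (x, y); split => //=; lra.
have [hB|hB] := leP `|A + B + (C + D)| (4 * `|B|).
  by exists (x + w', y); split => //=; lra.
have [hC|hC] := leP `|A + B + (C + D)| (4 * `|C|).
  by exists (x, y + h'); split => //=; lra.
by exists (x + w', y + h'); split => //=; lra.
Qed.

Fixpoint corner n : R * R :=
  if n is m.+1 then projT1 (cid (quarter m (corner m))) else (x0, y0).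

Let cornerS n : let p := corner n in let p' := corner n.+1 in
  [/\ p.1 <= p'.1, p'.1 + w n.+1 <= p.1 + w n, p.2 <= p'.2,
      p'.2 + h n.+1 <= p.2 + h n &
      `|circulation F G p.1 p.2 (w n) (h n)| <=
        4 * `|circulation F G p'.1 p'.2 (w n.+1) (h n.+1)| ].
Proof. by move=> /=; case: cid. Qed.

Let nested (c l : nat -> R) : (forall n, 0 <= l n) ->
  (forall n, c n <= c n.+1) -> (forall n, c n.+1 + l n.+1 <= c n + l n) ->
  exists t, forall n, c n <= t <= c n + l n.
Proof.
move=> l0 cS lS.
have cm : {homo c : m n / (m <= n)%N >-> m <= n}.
  by apply: homo_leq => //; exact: le_trans.
have lm : {homo (fun n => c n + l n) : m n / (m <= n)%N >-> n <= m}.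
  by apply: homo_leq => // a b d ab bd; exact: le_trans bd ab.
have cl m n : c m <= c n + l n.
  have [mn|/ltnW nm] := leqP m n.
    by rewrite (le_trans (cm _ _ mn))// lerDl.
  by rewrite (le_trans _ (lm _ _ nm))// lerDl.
have sc : has_sup (range c).
  by split; [exists (c 0%N), 0%N|exists (c 0%N + l 0%N) => _ [m _ <-]].
exists (sup (range c)) => n; apply/andP; split.
  by apply: sup_upper_bound => //; exists n.
by apply: sup_le_ub; [exact: sc.1|move=> _ [m _ <-]].
Qed.

(** Repeated quartering keeps |circulation| >= 4^-n times the initial one, while
    near the common point of the nested rectangles, whose sides shrink like
    2^-n, the circulation is o(4^-n). *)
Lemma goursat : circulation F G x0 y0 W H = 0.
Proof.
have w0 n : 0 <= w n by rewrite divr_ge0// exprn_ge0.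
have h0 n : 0 <= h n by rewrite divr_ge0// exprn_ge0.
have [x xP] : exists t, forall n, (corner n).1 <= t <= (corner n).1 + w n.
  by apply: nested => // n; have [] := cornerS n.
have [y yP] : exists t, forall n, (corner n).2 <= t <= (corner n).2 + h n.
  by apply: nested => // n; have [] := cornerS n.
have xy : in_rect x y.
  by have := xP 0%N; have := yP 0%N; rewrite /= /w /h expr0 !divr1.
have grow n : `|circulation F G x0 y0 W H| <=
    4 ^+ n * `|circulation F G (corner n).1 (corner n).2 (w n) (h n)|.
  elim: n => [|n IH]; first by rewrite expr0 mul1r /w /h expr0 !divr1.
  apply: le_trans IH _; rewrite exprSr -mulrA ler_pM2l ?exprn_gt0//.
  by have [] := cornerS n.
have cin n : [/\ x0 <= (corner n).1, (corner n).1 + w n <= x0 + W,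
    y0 <= (corner n).2 & (corner n).2 + h n <= y0 + H].
  elim: n => [|n [? ? ? ?]]; first by rewrite /= /w /h expr0 !divr1.
  by have [? ? ? ? _] := cornerS n; split; lra.
apply/eqP; rewrite -normr_le0; apply/ler_addgt0Pr => e e0; rewrite add0r.
have c0 : 0 < (W + H) ^+ 2 + 1 by rewrite ltr_wpDl// sqr_ge0.
have e'0 : 0 < e / ((W + H) ^+ 2 + 1) by rewrite divr_gt0.
have [d d0 loc] := circulation_local xy e'0.
have [n nd] : exists n, Num.max (w n) (h n) <= d.
  have lt2n m : (m%:R : R) <= 2 ^+ m by rewrite -natrX ler_nat ltnW// ltn_expl.
  pose N := Num.bound ((W + H) / d).
  have Wb : (W + H) / d <= N%:R.
    by apply/ltW/archi_boundP/divr_ge0; [exact: addr_ge0|exact: ltW].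
  have key : (W + H) / 2 ^+ N <= d.
    rewrite ler_pdivrMr ?exprn_gt0// mulrC -ler_pdivrMr//.
    exact: le_trans Wb (lt2n N).
  exists N; rewrite ge_max /w /h !(le_trans _ key)//.
    by rewrite ler_pM2r ?invr_gt0 ?exprn_gt0// lerDr.
  by rewrite ler_pM2r ?invr_gt0 ?exprn_gt0// lerDl.
move: nd; rewrite ge_max => /andP[wd hd].
have [c1 c2 c3 c4] := cin n.
have := loc (corner n).1 (corner n).2 (w n) (h n).
rewrite w0 wd h0 hd => /(_ isT isT c1 c2 c3 c4 (xP n) (yP n)) small.
apply: le_trans (grow n) _.
have := ler_wpM2l (exprn_ge0 n (ler0n R 4)) small.
move=> /le_trans; apply.
have -> : 4 ^+ n * (e / ((W + H) ^+ 2 + 1) * (w n + h n) ^+ 2) =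
    e * ((W + H) ^+ 2 / ((W + H) ^+ 2 + 1)).
  rewrite /w /h -mulrDl expr_div_n -exprM mulnC exprM.
  have -> : (2 ^+ 2 : R) = 4 by rewrite -natrX.
  by field; rewrite expf_neq0//= gt_eqF.
apply: ler_piMr; first exact: ltW.
by rewrite ler_pdivrMr// mul1r lerDl.
Qed.

End Goursat.

(** * Primitives of continuous functions *)

(** Zero to the left of the base point a, where the interval of integration is
    empty; derivatives are taken to the right of a. *)
Definition primitive (R : realType) (f : R -> R) (a x : R) : R :=
  (\int[@lebesgue_measure R]_(t in `[a, x]) f t)%R.

Lemma is_derive_primitive (R : realType) (f : R -> R) (a b x : R) :
  a < x < b -> (forall t, a <= t <= b -> {for t, continuous f}) ->
  is_derive x 1 (primitive f a) (f x).
Proof.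
move=> /andP[ax xb] fc.
have intf : (@lebesgue_measure R).-integrable `[a, b] (EFin \o f).
  apply: continuous_compact_integrable; first exact: segment_compact.
  exact: within_continuousW.
have fx : {for x, continuous f} by apply: fc; rewrite !ltW.
have [dF F'] := continuous_FTC1_closed xb intf ax fx.
by apply: DeriveDef; [exact: dF|rewrite -derive1E; exact: F'].
Qed.

(** * Moduli and complex derivatives *)

Section Modulus.
Variable R : realType.
Implicit Types z w : R[i].

Lemma normcE_real z : `|z| = (cmod z)%:C.
Proof. by rewrite normc_def; case: z. Qed.

Lemma cmod_ge0 z : 0 <= cmod z.
Proof. by case: z => a b; exact: sqrtr_ge0. Qed.

Lemma Im_le_cmod z : `|complex.Im z| <= cmod z.
Proof.
by case: z => a b /=; rewrite -sqrtr_sqr ler_wsqrtr// lerDr sqr_ge0.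
Qed.

Lemma Re_le_cmod z : `|complex.Re z| <= cmod z.
Proof.
by case: z => a b /=; rewrite -sqrtr_sqr ler_wsqrtr// lerDl sqr_ge0.
Qed.

Lemma cmod_le_ReIm z : cmod z <= `|complex.Re z| + `|complex.Im z|.
Proof.
case: z => a b /=; rewrite -ler_sqr ?nnegrE ?addr_ge0 ?sqrtr_ge0//.
rewrite sqr_sqrtr ?addr_ge0 ?sqr_ge0//.
by rewrite sqrrD !real_normK ?num_real// addrAC lerDl mulrn_wge0// mulr_ge0.
Qed.

Lemma cmod_real (a : R) : cmod a%:C = `|a|.
Proof. by rewrite /= expr0n /= addr0 sqrtr_sqr. Qed.

Lemma ReB z w : complex.Re (z - w) = complex.Re z - complex.Re w.
Proof. by case: z; case: w. Qed.

Lemma ImB z w : complex.Im (z - w) = complex.Im z - complex.Im w.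
Proof. by case: z; case: w. Qed.

End Modulus.

(** First-order approximation with real tolerances, the form of complex
    differentiability that composes with real curves. *)
Definition cdiff (R : realType) (f : R[i] -> R[i]) (z d : R[i]) :=
  forall e : R, 0 < e -> exists2 del : R, 0 < del &
    forall w, cmod (w - z) <= del ->
      cmod (f w - f z - d * (w - z)) <= e * cmod (w - z).

Lemma is_derive_approx (K : numFieldType) (f : K -> K) (x df : K) :
  is_derive (x : K^o) 1 (f : K^o -> K^o) df ->
  forall e, 0 < e -> exists2 del, 0 < del &
    forall y, `|y - x| < del -> `|f y - f x - df * (y - x)| <= e * `|y - x|.
Proof.
move=> [df1 dE] e e0; move: df1; rewrite /derivable => /cvg_ex[l lP].
have ld : l = df by rewrite -dE /derive; apply/esym/cvg_lim.
move: lP; rewrite {}ld => /cvgrPdist_le/(_ e e0).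
rewrite near_withinE => /nbhs_normP[r /= r0 rP].
exists r => // y yx; have [yxE|yx0] := eqVneq (y - x) 0.
  have -> : f y = f x by congr f; apply/eqP; rewrite -subr_eq0 yxE.
  by rewrite yxE subrr mulr0 subrr normr0 mulr0.
have := rP (y - x); rewrite /ball_ /= sub0r normrN => /(_ yx yx0).
rewrite /GRing.scale /= mulr1 subrK => le1.
have -> : f y - f x - df * (y - x) =
   - (df - (y - x)^-1 * (f y - f x)) * (y - x) by field.
by rewrite normrM normrN ler_wpM2r.
Qed.

Lemma is_derive_cdiff (R : realType) (f : R[i] -> R[i]) (z d : R[i]) :
  is_derive (z : R[i]^o) 1 (f : R[i]^o -> R[i]^o) d -> cdiff f z d.
Proof.
move=> /is_derive_approx fz e e0.
have [|r r0 rP] := fz e%:C; first by rewrite ltcR.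
have /complex_realP[s rs] : r \is Num.real by exact: gtr0_real.
move: r0 rP; rewrite rs ltcR => s0 rP.
exists (s / 2) => [|w wz]; first by rewrite divr_gt0.
have := rP w; rewrite !normcE_real ltcR -rmorphM lecR; apply.
by apply: le_lt_trans wz _; rewrite ltr_pdivrMr// mulr_natr mulr2n ltrDl.
Qed.

(** * Holomorphic functions in polar coordinates *)

Lemma diff2_mul (R : realType) (f g : R -> R) (x y a b : R) :
  is_derive x 1 f a -> is_derive y 1 g b ->
  diff2 (fun s t => f s * g t) x y (a * g y) (f x * b).
Proof.
move=> /is_derive_approx df /is_derive_approx dg e e0.
pose M := `|f x| + `|g y| + `|a| + `|b| + 1.
have M1 : 1 <= M by rewrite /M lerDr !addr_ge0.
have M0 : 0 < M by exact: lt_le_trans M1.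
have M30 : 0 < 3 * M by rewrite mulr_gt0.
pose e1 := Num.min 1 (e / (3 * M)).
have e10 : 0 < e1 by rewrite lt_min ltr01 divr_gt0.
have e11 : e1 <= 1 by rewrite ge_min lexx.
have Me1 : M * e1 <= e / 3.
  have -> : e / 3 = M * (e / (3 * M)) by field; rewrite gt_eqF.
  by rewrite ler_pM2l// ge_min lexx orbT.
have [d1 d10 fP] := df _ e10; have [d2 d20 gP] := dg _ e10.
pose d3 := e / (3 * (M * M)).
have d30 : 0 < d3 by rewrite divr_gt0// !mulr_gt0.
exists (Num.min (Num.min (d1 / 2) (d2 / 2)) d3).
  by rewrite !lt_min d30 !divr_gt0.
move=> s t; rewrite !le_min => /andP[/andP[sd1 _] sd3] /andP[/andP[_ td2] td3].
have {fP} fs : `|f s - f x - a * (s - x)| <= e1 * `|s - x| by apply: fP; lra.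
have {gP} gt : `|g t - g y - b * (t - y)| <= e1 * `|t - y| by apply: gP; lra.
have lip (u v c w : R) : `|c| + 1 <= M -> `|u - v - c * w| <= e1 * `|w| ->
    `|u - v| <= M * `|w|.
  move=> cM le1; rewrite -(subrK (c * w) (u - v)) (le_trans (ler_normD _ _))//.
  rewrite normrM; apply: (@le_trans _ _ ((1 + `|c|) * `|w|)); last first.
    by rewrite addrC ler_wpM2r.
  by rewrite mulrDl mul1r lerD2r (le_trans le1)// ler_piMl.
have aM : `|a| + 1 <= M.
  by rewrite /M lerD2r addrAC lerDr !addr_ge0.
have bM : `|b| + 1 <= M by rewrite /M lerD2r lerDr !addr_ge0.
have Lf := lip _ _ _ _ aM fs; have Lg := lip _ _ _ _ bM gt.
have -> : f s * g t - (f x * g y + a * g y * (s - x) + f x * b * (t - y)) =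
  (f s - f x) * (g t - g y) + g y * (f s - f x - a * (s - x))
   + f x * (g t - g y - b * (t - y)) by ring.
rewrite (le_trans (ler_normD _ _))//.
have -> : e * (`|s - x| + `|t - y|) = e / 3 * `|s - x| + e / 3 * `|t - y| +
  (e / 3 * `|s - x| + e / 3 * `|t - y|) +
  (e / 3 * `|s - x| + e / 3 * `|t - y|) by field.
have e30 : 0 <= e / 3 by rewrite divr_ge0// ltW.
apply: lerD; first rewrite (le_trans (ler_normD _ _))//; first apply: lerD.
- rewrite normrM; apply: (@le_trans _ _ (M * `|s - x| * (M * d3))).
    by rewrite ler_pM// (le_trans Lg)// ler_pM2l.
  have -> : M * `|s - x| * (M * d3) = e / 3 * `|s - x|.
    by rewrite /d3; field; rewrite gt_eqF.
  by rewrite lerDl mulr_ge0.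
- rewrite normrM; apply: (@le_trans _ _ (M * (e1 * `|s - x|))).
    rewrite ler_pM// /M -!addrA addrCA lerDl.
    by rewrite !addr_ge0.
  by rewrite mulrA (le_trans (ler_wpM2r _ Me1))// lerDl mulr_ge0.
- rewrite normrM; apply: (@le_trans _ _ (M * (e1 * `|t - y|))).
    rewrite ler_pM// /M -!addrA lerDl.
    by rewrite !addr_ge0.
  by rewrite mulrA (le_trans (ler_wpM2r _ Me1))// lerDr mulr_ge0.
Qed.

Section Diff2Continuity.
Variables (R : realType) (f : R -> R -> R) (x y fx fy : R).
Hypothesis df : diff2 f x y fx fy.



Lemma diff2_continuous1 : {for x, continuous (f^~ y)}.
Proof.
apply/cvgrPdist_le => /= e e0.
have [d d0 dP] := df ltr01.
have M0 : 0 < `|fx| + 1 by rewrite ltr_wpDl.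
apply/nbhs_normP; exists (Num.min d (e / (`|fx| + 1))).
  by rewrite /= lt_min d0 divr_gt0.
move=> s; rewrite /ball_ /= distrC lt_min => /andP[/ltW sd /ltW se].
have := dP s y sd; rewrite subrr normr0 mulr0 !addr0 mul1r => /(_ (ltW d0)) le1.
rewrite distrC -(subrK (fx * (s - x)) (f s y - _)).
rewrite (le_trans (ler_normD _ _))// normrM.
move: le1; rewrite opprD addrA => le1.
rewrite (le_trans (lerD le1 (lexx _)))//.
rewrite (_ : _ + _ = `|s - x| * (`|fx| + 1)); last by ring.
by rewrite -ler_pdivlMr.
Qed.

End Diff2Continuity.

Lemma diff2_swap (R : realType) (f : R -> R -> R) (x y fx fy : R) :
  diff2 f x y fx fy -> diff2 (fun s t => f t s) y x fy fx.
Proof.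
move=> df e e0; have [d d0 dP] := df e e0; exists d => // s t sd td.
by rewrite addrAC (addrC `|s - y|); exact: dP.
Qed.

Lemma diff2_continuous2 (R : realType) (f : R -> R -> R) (x y fx fy : R) :
  diff2 f x y fx fy -> {for y, continuous (f x)}.
Proof. by move=> /diff2_swap /diff2_continuous1. Qed.

Definition polar (R : realType) (s t : R) : R[i] :=
  (expR s * cos t) +i* (expR s * sin t).

Lemma cmod_polar (R : realType) (s t : R) : cmod (polar s t) = expR s.
Proof.
rewrite /polar /= !exprMn -mulrDr cos2Dsin2 mulr1 sqrtr_sqr.
by rewrite ger0_norm// expR_ge0.
Qed.

Lemma polar_approx (R : realType) (x y : R) : forall e : R, 0 < e ->
  exists2 d : R, 0 < d & forall s t, `|s - x| <= d -> `|t - y| <= d ->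
    cmod (polar s t - polar x y - polar x y * ((s - x) +i* (t - y)))
      <= e * (`|s - x| + `|t - y|).
Proof.
move=> e e0; have e20 : 0 < e / 2 by rewrite divr_gt0.
have [d1 d10 P1] := diff2_mul (is_derive_expR x) (is_derive_cos y) e20.
have [d2 d20 P2] := diff2_mul (is_derive_expR x) (is_derive_sin y) e20.
exists (Num.min d1 d2) => [|s t]; first by rewrite lt_min d10.
rewrite !le_min => /andP[s1 s2] /andP[t1 t2].
apply: (le_trans (cmod_le_ReIm _)).
have -> : e * (`|s - x| + `|t - y|) =
  e / 2 * (`|s - x| + `|t - y|) + e / 2 * (`|s - x| + `|t - y|) by field.
apply: lerD.
- apply: le_trans (P1 s t s1 t1); rewrite le_eqVlt; apply/orP; left.
  by apply/eqP; congr (`|_|); rewrite /polar; simpc => /=; ring.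
- apply: le_trans (P2 s t s2 t2); rewrite le_eqVlt; apply/orP; left.
  by apply/eqP; congr (`|_|); rewrite /polar; simpc => /=; ring.
Qed.

Lemma polar_chain (R : realType) (g : R[i] -> R[i]) (x y : R) (d : R[i]) :
  cdiff g (polar x y) d -> forall e : R, 0 < e ->
  exists2 del : R, 0 < del & forall s t, `|s - x| <= del -> `|t - y| <= del ->
    cmod (g (polar s t) - g (polar x y) -
      d * polar x y * ((s - x) +i* (t - y))) <= e * (`|s - x| + `|t - y|).
Proof.
move=> dg e e0.
set p := polar x y in dg *.
pose K := cmod p + cmod d + 1.
have K1 : 1 <= K by rewrite lerDr addr_ge0// cmod_ge0.
have K0 : 0 < K by exact: lt_le_trans K1.
have e20 : 0 < e / (2 * K) by rewrite divr_gt0// mulr_gt0.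
pose e1 := Num.min 1 (e / (2 * K)).
have e10 : 0 < e1 by rewrite lt_min ltr01.
have [r r0 gP] := dg _ e20.
have [del del0 pP] := polar_approx x y e10.
exists (Num.min del (r / (2 * K))).
  by rewrite lt_min del0 divr_gt0// mulr_gt0.
move=> s t; rewrite !le_min => /andP[s1 s2] /andP[t1 t2].
have {pP} := pP s t s1 t1; rewrite -/p.
set q := polar s t; set h := (s - x) +i* (t - y) => pP.
have hn : cmod h <= `|s - x| + `|t - y| by exact: cmod_le_ReIm.
set N := `|s - x| + `|t - y| in hn pP *.
have N0 : 0 <= N by rewrite addr_ge0.
have e1K : e1 * N <= N by rewrite ler_piMl// ge_min lexx.
have e1K' : e1 * N <= e / (2 * K) * N by rewrite ler_wpM2r// ge_min lexx orbT.
have qp : cmod (q - p) <= K * N.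
  rewrite -(subrK (p * h) (q - p)) (le_trans (le_normcD _ _))//.
  rewrite ComplexField.Normc.normcM.
  have ph : cmod p * cmod h <= cmod p * N by rewrite ler_wpM2l// cmod_ge0.
  have dN : 0 <= cmod d * N by rewrite mulr_ge0// cmod_ge0.
  rewrite /K !mulrDl mul1r; lra.
have qr : cmod (q - p) <= r.
  apply: le_trans qp _; have -> : r = K * (r / (2 * K) + r / (2 * K)).
    by field; rewrite gt_eqF.
  by rewrite ler_pM2l// lerD.
have := gP q qr => gq.
have -> : g q - g p - d * p * h = (g q - g p - d * (q - p)) +
  d * (q - p - p * h) by ring.
apply: le_trans (le_normcD _ _) _; rewrite ComplexField.Normc.normcM.
have -> : e * N = e / (2 * K) * (K * N) + K * (e / (2 * K) * N).
  by field; rewrite gt_eqF.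
apply: lerD; first by rewrite (le_trans gq)// ler_pM2l.
rewrite ler_pM ?cmod_ge0// ?(le_trans pP)//.
by rewrite /K addrAC addrC lerDl ?addr_ge0 ?cmod_ge0.
Qed.

(** With D = g'(z) z, the derivative of g (polar s t) is D along s and iD along
    t. The two lemmas below are the Cauchy-Riemann equations: the t-derivative
    of - Re g and the s-derivative of Im g are both Im D. *)
Lemma diff2_Im_polar (R : realType) (g : R[i] -> R[i]) (x y : R) (d : R[i]) :
  cdiff g (polar x y) d ->
  diff2 (fun s t => complex.Im (g (polar s t))) x y
    (complex.Im (d * polar x y)) (complex.Re (d * polar x y)).
Proof.
move=> /polar_chain dg e e0; have [del del0 gP] := dg e e0.
exists del => // s t sd td; apply: le_trans (gP s t sd td).
apply: le_trans (Im_le_cmod _); rewrite le_eqVlt; apply/orP; left.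
apply/eqP; congr (`|_|); rewrite !ImB.
by case: (d * _) => a b /=; ring.
Qed.

Lemma diff2_Re_polar (R : realType) (g : R[i] -> R[i]) (x y : R) (d : R[i]) :
  cdiff g (polar x y) d ->
  diff2 (fun s t => - complex.Re (g (polar s t))) x y
    (- complex.Re (d * polar x y)) (complex.Im (d * polar x y)).
Proof.
move=> /polar_chain dg e e0; have [del del0 gP] := dg e e0.
exists del => // s t sd td; apply: le_trans (gP s t sd td).
apply: le_trans (Re_le_cmod _); rewrite -[leRHS]normrN le_eqVlt.
apply/orP; left.
apply/eqP; congr (`|_|); rewrite !ReB.
by case: (d * _) => a b /=; ring.
Qed.

(** Goursat's theorem on [ln r, ln rho] x [0, 2 pi] equates the integrals of
    Im g over the two circles, as the sides t = 0 and t = 2 pi cancel by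
    periodicity. The mean value theorem turns equal means into equal values. *)
Lemma equal_Im_on_circles (R : realType) (g : R[i] -> R[i]) (r rho : R) :
  0 < r -> r <= rho -> rho < 1 ->
  (forall z, 0 < cmod z < 1 -> exists d, cdiff g z d) ->
  exists z w,
    [/\ cmod z = rho, cmod w = r & complex.Im (g z) = complex.Im (g w)].
Proof.
move=> r0 rrho rho1 dg.
have rho0 : 0 < rho by exact: lt_le_trans rrho.
pose s0 := ln r; pose s1 := ln rho.
have s01 : s0 <= s1 by rewrite ler_ln.
have s10 : s1 < 0 by rewrite ln_lt0// rho0.
pose T : R := pi *+ 2.
have T0 : 0 < T by rewrite mulrn_wgt0// pi_gt0.
pose P s t := - complex.Re (g (polar s t)).
pose Q s t := complex.Im (g (polar s t)).
have dgp (s t : R) : s < 0 -> exists d, cdiff g (polar s t) d.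
  by move=> sl0; apply: dg; rewrite cmod_polar expR_gt0 expR_lt1.
pose F s t := primitive (P^~ t) (s0 - 1) s.
pose G s t := primitive (Q s) (-1) t.
have dF s t : s0 <= s <= s1 -> is_derive s 1 (F^~ t) (P s t).
  move=> ?; apply: (@is_derive_primitive _ (P^~ t) _ (s1 / 2)); first lra.
  move=> u ?; have [|d /diff2_Re_polar] := dgp u t; first lra.
  exact: diff2_continuous1.
have dG (s t : R) : s0 <= s <= s1 -> 0 <= t <= T -> is_derive t 1 (G s) (Q s t).
  move=> ? ?; apply: (@is_derive_primitive _ (Q s) _ (T + 1)); first lra.
  move=> u ?; have [|d /diff2_Im_polar] := dgp s u; first lra.
  exact: diff2_continuous2.
have W0 : 0 <= s1 - s0 by lra.
have rectE (s t : R) : s0 <= s <= s0 + (s1 - s0) /\ 0 <= t <= 0 + T ->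
    s0 <= s <= s1 /\ 0 <= t <= T.
  by rewrite add0r (addrC s0) subrK.
have closed_form (s t : R) : s0 <= s <= s0 + (s1 - s0) /\ 0 <= t <= 0 + T ->
    exists px m qy, diff2 P s t px m /\ diff2 Q s t m qy.
  move=> /rectE[? _]; have [|d dgz] := dgp s t; first lra.
  exists (- complex.Re (d * polar s t)), (complex.Im (d * polar s t)),
    (complex.Re (d * polar s t)).
  by split; [exact: diff2_Re_polar|exact: diff2_Im_polar].
have circ0 := goursat W0 (ltW T0) (fun s t st => dF s t (rectE s t st).1)
  (fun s t st => dG s t (rectE s t st).1 (rectE s t st).2) closed_form.
have Fper s : F s T = F s 0.
  rewrite /F; congr primitive; apply/funext => u; rewrite /P /polar /T.
  by rewrite cos2pi sin2pi cos0 sin0.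
clearbody F G T.
have [b1 b1P G1] := mean_value (ltW T0) (dG s1 ^~ ltac:(lra)).
have [b0 b0P G0] := mean_value (ltW T0) (dG s0 ^~ ltac:(lra)).
exists (polar s1 b1), (polar s0 b0); rewrite !cmod_polar !lnK//; split => //.
apply: (mulIf (lt0r_neq0 T0)).
move: circ0 G1 G0; rewrite /circulation add0r subr0 addrC.
rewrite (_ : s0 + (s1 - s0) = s1); last by rewrite addrC subrK.
rewrite (Fper s1) (Fper s0) /Q => circ0 <- <-; lra.
Qed.

(** * Rules of differentiation over a field *)

Section FieldDerivative.
Variable K : numFieldType.
Implicit Types (f g : K -> K) (x c df dg : K).

(** A derivative of a function from the field to itself, hiding the passage to
    the regular module K^o, so that the rules below apply to plain functions. *)
Definition fderiv f x df := is_derive (x : K^o) 1 (f : K^o -> K^o) df.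

Lemma fderiv_cst c x : fderiv (fun=> c) x 0.
Proof. exact: (@is_derive_cst K K^o K^o). Qed.

Lemma fderiv_id x : fderiv id x 1.
Proof. exact: (@is_derive_id K K^o). Qed.

Lemma fderivD f g x df dg : fderiv f x df -> fderiv g x dg ->
  fderiv (fun t => f t + g t) x (df + dg).
Proof. exact: (@is_deriveD K K^o K^o). Qed.

Lemma fderivB f g x df dg : fderiv f x df -> fderiv g x dg ->
  fderiv (fun t => f t - g t) x (df - dg).
Proof. exact: (@is_deriveB K K^o K^o). Qed.

Lemma fderivM f g x df dg : fderiv f x df -> fderiv g x dg ->
  fderiv (fun t => f t * g t) x (f x * dg + g x * df).
Proof. exact: (@is_deriveM K K^o). Qed.

Lemma fderivV f x df : f x != 0 -> fderiv f x df ->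
  fderiv (fun t => (f t)^-1) x (- (f x) ^- 2 * df).
Proof.
move=> fx0 [f1 fE]; split; first exact: (@derivableV K K^o).
by rewrite -fE; exact: (@deriveV K K^o).
Qed.

Lemma fderiv_comp f g x df dg : fderiv f x df -> fderiv g (f x) dg ->
  fderiv (fun t => g (f t)) x (dg * df).
Proof.
move=> [f1 fE] [g1 gE].
have fd := (derivable1_diffP (f : K^o -> K^o) x).1 f1.
have gd := (derivable1_diffP (g : K^o -> K^o) (f x)).1 g1.
have gfd := differentiable_comp fd gd.
split; first exact: (derivable1_diffP (g \o f : K^o -> K^o) x).2.
have dgf : 'd (g \o f : K^o -> K^o) x (1 : K^o) =
    'd (g : K^o -> K^o) (f x) ('d (f : K^o -> K^o) x (1 : K^o)).
  exact: (congr1 (fun D => D (1 : K^o)) (diff_comp fd gd)).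
have dfE : 'd (f : K^o -> K^o) x (1 : K^o) = df.
  by rewrite -fE; exact: (esym (deriveE (1 : K^o) fd)).
apply: (etrans (deriveE (1 : K^o) gfd)).
apply: (etrans (etrans dgf (congr1 _ dfE))).
have := deriv1E g1; set D := 'd _ _; move: D => D ->.
by rewrite derive1E gE mulrC.
Qed.

End FieldDerivative.

(** * The Schwarz-Pick inequality *)

Section Disc.
Variable R : realType.
Implicit Types (h g : R[i] -> R[i]) (z w b d : R[i]).

(** On |b z| = 1 the inverse of b z is its conjugate. There
    h (2 + b z) + h / (b z) is h times the real weight 2 + 2 Re(b z), and the
    terms in h 0, which remove the pole at 0, add up to the real number
    - 2 Re(h(0) / (b z)). *)
Definition tilt h b z : R[i] :=
  h z * (2 + b * z) - (h 0)^* * (b * z) + (h z - h 0) / (b * z).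

Lemma tilt_Im h b z : cmod (b * z) = 1 ->
  complex.Im (tilt h b z) =
    2 * complex.Im (h z) * (1 + complex.Re (b * z)).
Proof.
rewrite /tilt; move: (b * z) (h z) (h 0) => [u v] [p q] [p0 q0] uv.
have uv1 : u ^+ 2 + v ^+ 2 = 1.
  move: uv => /= uv.
  by rewrite -(sqr_sqrtr (addr_ge0 (sqr_ge0 u) (sqr_ge0 v))) uv expr1n.
have -> : ((u +i* v)^-1 : R[i]) = u -i* v.
  transitivity ((u / (u ^+ 2 + v ^+ 2)) -i* (v / (u ^+ 2 + v ^+ 2))) => //.
  by rewrite uv1 !divr1.
have -> : (2 : R[i]) = 2 +i* 0 by rewrite (_ : (2 : R[i]) = 2%:C)// rmorphMn.
by simpc => /=; ring.
Qed.

Lemma tilt_limit h b d : b != 0 -> fderiv h 0 d ->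
  forall e : R, 0 < e -> exists2 del, 0 < del & forall z, 0 < cmod z <= del ->
    cmod (tilt h b z - (2 * h 0 + d / b)) <= e.
Proof.
move=> b0 /is_derive_cdiff dh e e0.
have B0 : 0 < cmod b.
  rewrite lt_neqAle cmod_ge0 andbT eq_sym; apply: contra_neq b0.
  exact: ComplexField.Normc.eq0_normc.
set B := cmod b in B0; set m := cmod (h 0 - (h 0)^*).
have m0 : 0 <= m by exact: cmod_ge0.
pose K := cmod d + 1.
have K0 : 0 < K by rewrite ltr_wpDl// cmod_ge0.
pose e1 := Num.min 1 (e * B / 2).
have e10 : 0 < e1 by rewrite lt_min ltr01 divr_gt0// mulr_gt0.
have e11 : e1 <= 1 by rewrite ge_min lexx.
have e1B : e1 / B <= e / 2.
  by rewrite ler_pdivrMr// mulrAC ge_min lexx orbT.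
have [r r0 hP] := dh e1 e10.
pose C := K * (2 + B) + m * B.
have C0 : 0 < C.
  by apply: ltr_wpDr; [rewrite mulr_ge0// ltW|rewrite mulr_gt0// addr_gt0].
exists (Num.min (Num.min 1 r) (e / (2 * C))).
  by rewrite !lt_min ltr01 r0 divr_gt0// mulr_gt0.
move=> z; rewrite !le_min => /andP[z0 /andP[/andP[z1 zr] ze]].
have z_neq0 : z != 0.
  by apply: contraTneq z0 => ->; rewrite ComplexField.Normc.normc0 ltxx.
have := hP z; rewrite subr0 => /(_ zr) hz.
have hz' : cmod (h z - h 0) <= K * cmod z.
  rewrite -(subrK (d * z) (h z - h 0)) (le_trans (le_normcD _ _))//.
  rewrite ComplexField.Normc.normcM /K mulrDl mul1r addrC lerD2l.
  by rewrite (le_trans hz)// ler_piMl// cmod_ge0.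
have -> : tilt h b z - (2 * h 0 + d / b) =
  ((h z - h 0) * (2 + b * z) + (h 0 - (h 0)^*) * (b * z))
  + (h z - h 0 - d * z) / (b * z).
  rewrite /tilt; move: (h z) (h 0) ((h 0)^*) => p p0 p1.
  by field; rewrite b0 z_neq0.
have c2 : cmod (2 : R[i]) = 2.
  have -> : (2 : R[i]) = (2 : R)%:C by rewrite rmorph_nat.
  by rewrite cmod_real ger0_norm.
apply: le_trans (le_normcD _ _) _.
have -> : e = C * (e / (2 * C)) + e / 2 by field; rewrite gt_eqF.
apply: lerD.
  apply: (@le_trans _ _ (C * cmod z)); last by rewrite ler_pM2l.
  have -> : C * cmod z = K * (2 + B) * cmod z + m * B * cmod z.
    by rewrite /C mulrDl.
  rewrite (le_trans (le_normcD _ _))// lerD//.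
    rewrite ComplexField.Normc.normcM mulrAC ler_pM ?cmod_ge0//.
    rewrite (le_trans (le_normcD _ _))// c2 lerD2l ComplexField.Normc.normcM.
    by rewrite ler_piMr// cmod_ge0.
  by rewrite !ComplexField.Normc.normcM mulrA.
rewrite ComplexField.Normc.normcM ComplexField.Normc.normcV.
rewrite ComplexField.Normc.normcM -/B.
apply: le_trans e1B; rewrite ler_pdivrMr ?mulr_gt0//.
by apply: le_trans hz _; rewrite mulrA divfK ?gt_eqF.
Qed.

(** For |b| = 1/rho the tilt of h has nonnegative imaginary part on |z| = rho,
    hence a nonnegative value at some point of every smaller circle, and in the
    limit Im (2 h(0) + d / b) >= 0. The argument of b is chosen to make d / b a
    negative multiple of i. *)
Lemma borel_caratheodory h d :
  (forall z, cmod z < 1 -> exists d, fderiv h z d) -> fderiv h 0 d ->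
  (forall z, cmod z < 1 -> 0 <= complex.Im (h z)) ->
  cmod d <= 2 * complex.Im (h 0).
Proof.
move=> dh dh0 h_ge0.
have h00 : 0 <= complex.Im (h 0).
  by apply: h_ge0; rewrite ComplexField.Normc.normc0.
have [d0|d_neq0] := eqVneq d 0.
  by rewrite d0 ComplexField.Normc.normc0 mulr_ge0.
have cd : 0 < cmod d.
  rewrite lt_neqAle cmod_ge0 andbT eq_sym; apply: contra_neq d_neq0.
  exact: ComplexField.Normc.eq0_normc.
suff bound rho : 0 < rho < 1 -> rho * cmod d <= 2 * complex.Im (h 0).
  apply/ler_addgt0Pr => e e0.
  pose s := Num.min (1 / 2) (e / cmod d).
  have s0 : 0 < s by rewrite lt_min !divr_gt0.
  have s1 : s <= 1 / 2 by rewrite ge_min lexx.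
  have se : s * cmod d <= e by rewrite -ler_pdivlMr// ge_min lexx orbT.
  have := bound (1 - s); rewrite mulrBl mul1r => B.
  have : 0 < 1 - s < 1 by lra.
  by move=> /B; lra.
move=> /andP[rho0 rho1].
pose b : R[i] := 'i%C * d / (rho * cmod d)%:C.
have rd0 : rho * cmod d != 0 by rewrite mulf_neq0 ?gt_eqF.
have rdC : ((rho * cmod d)%:C : R[i]) != 0 by rewrite fmorph_eq0.
have i0 : ('i%C : R[i]) != 0 
  by rewrite eq_complex /= oner_eq0 andbF.
have b0 : b != 0 by rewrite !mulf_neq0 ?invr_eq0.
have cb : cmod b = rho^-1.
  rewrite /b !ComplexField.Normc.normcM ComplexField.Normc.normcV cmod_real.
  have -> : cmod ('i%C : R[i]) = 1 by rewrite /= expr0n expr1n add0r sqrtr1.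
  by rewrite ger0_norm ?mulr_ge0 ?ltW// invfM; field; rewrite !gt_eqF.
have db : d / b = 'i%C^-1 * (rho * cmod d)%:C.
  rewrite /b; move: ('i%C : R[i]) i0 (_%:C) rdC => i i0' A A0.
  by field; rewrite i0' A0 d_neq0.
have Lim : complex.Im (2 * h 0 + d / b) = 2 * complex.Im (h 0) - rho * cmod d.
  rewrite db.
  have -> : ('i%C^-1 : R[i]) = 0 -i* 1.
    by apply: (mulfI i0); rewrite mulfV//; simpc.
  have -> : (2 : R[i]) = 2 +i* 0 by rewrite (_ : (2 : R[i]) = 2%:C)// rmorphMn.
  by case: (h 0) => p q; simpc => /=; ring.
suff : 0 <= complex.Im (2 * h 0 + d / b) by rewrite Lim subr_ge0.
apply/ler_addgt0Pr => e e0.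
have [del del0 near0] := tilt_limit b0 dh0 e0.
pose r := Num.min del rho.
have r0 : 0 < r by rewrite lt_min del0.
have rrho : r <= rho by rewrite ge_min lexx orbT.
have rdel : r <= del by rewrite ge_min lexx.
have [|z [w [zr wr zw]]] := equal_Im_on_circles (g := tilt h b) r0 rrho rho1.
  move=> z /andP[z0 z1]; have [dz dhz] := dh z z1.
  have bz0 : b * z != 0.
    rewrite mulf_neq0//; apply: contraTneq z0 => ->.
    by rewrite ComplexField.Normc.normc0 ltxx.
  have dbz := fderivM (fderiv_cst b z) (fderiv_id z).
  have T1 := fderivM dhz (fderivD (fderiv_cst 2 z) dbz).
  have T2 := fderivM (fderiv_cst ((h 0)^*) z) dbz.
  have T3 := fderivM (fderivB dhz (fderiv_cst (h 0) z)) (fderivV bz0 dbz).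
  have T := fderivD (fderivB T1 T2) T3.
  by eexists; exact: is_derive_cdiff T.
have zpos : 0 <= complex.Im (tilt h b z).
  have bz1 : cmod (b * z) = 1.
    by rewrite ComplexField.Normc.normcM cb zr mulVf// gt_eqF.
  rewrite tilt_Im//; apply: mulr_ge0.
    by rewrite mulr_ge0// h_ge0// zr.
  have := Re_le_cmod (b * z); rewrite bz1 ler_norml; lra.
have := near0 w; rewrite wr r0 rdel => /(_ isT) we.
have := le_trans (Im_le_cmod _) we; rewrite ImB ler_norml -zw; lra.
Qed.

End Disc.

(** The map c sends 0 to z and the unit disc into the upper half-plane, with
    derivative 2 i Im z at 0; apply [borel_caratheodory] to q o c. *)
Lemma schwarz_pick (R : realType) (q : R[i] -> R[i]) (z d : R[i]) :
  (forall w, 0 < complex.Im w -> exists dw, fderiv q w dw) ->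
  (forall w, 0 < complex.Im w -> 0 <= complex.Im (q w)) ->
  0 < complex.Im z -> fderiv q z d ->
  complex.Im z * cmod d <= complex.Im (q z).
Proof.
move=> dq q_ge0 z0 dqz.
pose c (w : R[i]) : R[i] := (z - z^* * w) / (1 - w).
have c0 : c 0 = z by rewrite /c mulr0 !subr0 divr1.
have one_sub (w : R[i]) : cmod w < 1 -> 1 - w != 0.
  apply: contraTneq => /subr0_eq <-.
  by rewrite ComplexField.Normc.normc1 ltxx.
have dc w : cmod w < 1 -> fderiv c w ((z - z^*) / (1 - w) ^+ 2).
  move=> /one_sub w1.
  have D1 := fderivB (fderiv_cst z w)
    (fderivM (fderiv_cst (z^*) w) (fderiv_id w)).
  have D2' := fderivB (fderiv_cst 1 w) (fderiv_id w).
  have D2 := fderivV (f := fun t => 1 - t) w1 D2'.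
  have := fderivM D1 D2.
  by congr (fderiv c w _); field.
have c_gt0 w : cmod w < 1 -> 0 < complex.Im (c w).
  move=> w1; have := one_sub w w1; rewrite /c.
  case: z z0 {dqz c c0 dc} => x y; case: w w1 => u v uv.
  have {uv} uv : u ^+ 2 + v ^+ 2 < 1.
    move: uv => /= uv.
    rewrite -(sqr_sqrtr (addr_ge0 (sqr_ge0 u) (sqr_ge0 v))).
    by rewrite expr_lt1// sqrtr_ge0.
  move=> y0' w1; have {y0'} y0 : 0 < y := y0'.
  have n0 : 0 < (1 - u) ^+ 2 + v ^+ 2.
    rewrite lt_neqAle addr_ge0 ?sqr_ge0// andbT eq_sym; apply: contraNneq w1.
    move/eqP; rewrite paddr_eq0 ?sqr_ge0// !sqrf_eq0 => /andP[/eqP u1 /eqP v0].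
    by rewrite eq_complex /= u1 v0 subr0 !eqxx.
  have -> : ((1 - (u +i* v))^-1 : R[i]) =
      ((1 - u) / ((1 - u) ^+ 2 + v ^+ 2)) +i* (v / ((1 - u) ^+ 2 + v ^+ 2)).
    apply: (mulfI w1); rewrite mulfV//; simpc; apply/eqP.
    have n0' := lt0r_neq0 n0.
    by rewrite eq_complex /=; apply/andP; split; apply/eqP; field.
  rewrite (_ : complex.Im _ =
    y * (1 - (u ^+ 2 + v ^+ 2)) / ((1 - u) ^+ 2 + v ^+ 2)).
    by rewrite divr_gt0// mulr_gt0// subr_gt0.
  have n0' := lt0r_neq0 n0.
  by simpc => /=; field.
have := @borel_caratheodory R (fun w => q (c w))
  (d * ((z - z^*) / (1 - 0) ^+ 2)).
rewrite c0 => B.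
have {B} : cmod (d * ((z - z^*) / (1 - 0) ^+ 2)) <= 2 * complex.Im (q z).
  apply: B.
  - move=> w w1; have [dw qw] := dq _ (c_gt0 _ w1).
    by eexists; exact: fderiv_comp (dc w w1) qw.
  - apply: (@fderiv_comp _ c q 0).
      by apply: dc; rewrite ComplexField.Normc.normc0.
    by rewrite c0.
  - by move=> w w1; apply/q_ge0/c_gt0.
rewrite subr0 expr1n divr1 ComplexField.Normc.normcM.
have -> : cmod (z - z^*) = 2 * complex.Im z.
  case: z z0 {dqz c c0 dc c_gt0} => x y /= y0; rewrite subrr expr0n add0r opprK.
  by rewrite sqrtr_sqr -mulr2n mulr_natl ger0_norm// mulrn_wge0// ltW.
by rewrite mulrCA ler_pM2l// mulrC.
Qed.

(** * Differential inequalities on the real line *)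

Section RealVariable.
Variable R : realType.
Implicit Types (u v : R -> R).

Lemma approx_is_derive u (x du : R) :
  (forall e, 0 < e -> exists2 del, 0 < del & forall y, `|y - x| <= del ->
    `|u y - u x - du * (y - x)| <= e * `|y - x|) -> is_derive x 1 u du.
Proof.
move=> uP.
have lim : h^-1 *: ((u \o shift x) (h *: 1) - u x) @[h --> 0^'] --> du.
  apply/cvgrPdist_le => e e0; have [del del0 uy] := uP e e0.
  rewrite near_withinE; apply/nbhs_normP; exists del => // h.
  rewrite /ball_ /= sub0r normrN => hdel h0.
  have := uy (h + x); rewrite addrK => /(_ (ltW hdel)) le1.
  rewrite /GRing.scale /= mulr1.
  have -> : du - h^-1 * (u (h + x) - u x) =
    - (h^-1 * (u (h + x) - u x - du * h)) by field.
  by rewrite normrN normrM normfV ler_pdivrMl ?normr_gt0// (mulrC `|h|).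
split; first by apply/cvg_ex; exists du.
exact: cvg_lim lim.
Qed.

Lemma nondecreasing_of_derive u (du : R -> R) (a b : R) : a <= b ->
  (forall x, a <= x <= b -> is_derive x 1 u (du x)) ->
  (forall x : R, a <= x <= b -> 0 <= du x) -> u a <= u b.
Proof.
move=> ab dux du0; have [c cab uab] := mean_value ab dux.
by rewrite -subr_ge0 uab mulr_ge0 ?du0 ?subr_ge0.
Qed.

Section Oscillation.
Variables (u v du dv : R -> R).
Hypothesis dv_v : forall t : R, 0 < t -> is_derive t 1 v (dv t).
Hypothesis du_u : forall t : R, 0 < t -> is_derive t 1 u (du t).
Hypothesis dv_le : forall t : R, 0 < t -> t * `|dv t| <= v t.
Hypothesis du_le : forall t : R, 0 < t -> t * `|du t| <= v t.

(** This lemma and [div_id_nonincreasing] are the two halves of Harnack's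
    inequality. *)
Lemma mul_id_nondecreasing (s r : R) : 0 < s -> s <= r -> v s * s <= v r * r.
Proof.
move=> s0 sr.
apply: (nondecreasing_of_derive (u := fun t => v t * t)
  (du := fun t => v t + t * dv t) sr) => t st.
  have t0 : 0 < t by lra.
  apply: is_derive_eq.
    exact: (@is_deriveM R R^o v id t 1 (dv t) 1 (dv_v t0) (is_derive_id t 1)).
  by rewrite /GRing.scale /= mulr1.
have t0 : 0 < t by lra.
have : `|t * dv t| <= v t by rewrite normrM (gtr0_norm t0) dv_le.
rewrite ler_norml; lra.
Qed.

Let is_derive_inv (t : R) : 0 < t ->
  is_derive t 1 (fun x : R => x^-1) (- t ^- 2).
Proof.
move=> t0; have t_neq0 : t != 0 by rewrite gt_eqF.
have := fderivV (f := id) t_neq0 (fderiv_id t).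
by rewrite mulr1.
Qed.

Lemma div_id_nonincreasing (s r : R) : 0 < s -> s <= r -> v r / r <= v s / s.
Proof.
move=> s0 sr; rewrite -lerN2.
apply: (nondecreasing_of_derive (u := fun t => - (v t / t))
  (du := fun t => - (v t * - t ^- 2 + t^-1 * dv t)) sr) => t st.
  have t0 : 0 < t by lra.
  apply: is_deriveN.
  exact: (@is_deriveM R R^o v (fun x => x^-1) t 1 _ _
    (dv_v t0) (is_derive_inv t0)).
have t0 : 0 < t by lra.
have : `|t * dv t| <= v t by rewrite normrM (gtr0_norm t0) dv_le.
rewrite ler_norml => le1.
have -> : - (v t * - t ^- 2 + t^-1 * dv t) = (v t - t * dv t) / t ^+ 2.
  by field; rewrite gt_eqF.
by rewrite divr_ge0 ?sqr_ge0//; lra.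
Qed.

(** On [s, r] the derivative of u is at most v(t) / t <= v(r) r / t^2, so both
    u(t) + v(r) r / t and its analogue for - u are nonincreasing. *)
Lemma oscillation_down (s r : R) : 0 < s -> s <= r ->
  `|u s - u r| <= v r * (r / s - 1).
Proof.
move=> s0 sr; have r0 : 0 < r by exact: lt_le_trans sr.
have mono (sg : R) : `|sg| = 1 ->
    - (sg * u s + v r * r / s) <= - (sg * u r + v r * r / r).
  move=> sg1.
  apply: (nondecreasing_of_derive (u := fun t => - (sg * u t + v r * r / t))
    (du := fun t => - (sg * du t + v r * r * - t ^- 2)) sr) => t st.
    have t0 : 0 < t by lra.
    apply: is_deriveN; apply: is_deriveD; apply: is_deriveZ.
      exact: du_u.
    exact: is_derive_inv.
  have t0 : 0 < t by lra.
  have t20 : 0 < t ^+ 2 by rewrite exprn_gt0.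
  have le1 : t * `|sg * du t| <= v t by rewrite normrM sg1 mul1r du_le.
  have tr : t <= r by lra.
  have le2 : t ^+ 2 * `|sg * du t| <= v r * r.
    rewrite expr2 -mulrA (le_trans (ler_wpM2l (ltW t0) le1))// mulrC.
    exact: mul_id_nondecreasing.
  have -> : - (sg * du t + v r * r * - t ^- 2) =
      (v r * r - t ^+ 2 * (sg * du t)) / t ^+ 2.
    by field; rewrite gt_eqF.
  apply: divr_ge0; last exact: ltW.
  by rewrite subr_ge0 (le_trans _ le2)// ler_wpM2l ?ler_norm// ltW.
have -> : v r * (r / s - 1) = v r * r / s - v r * r / r.
  by field; rewrite !gt_eqF.
have m1 := mono 1 (normr1 _); have m2 := mono (- 1) (normrN1 _).
by rewrite ler_norml; lra.
Qed.

Lemma oscillation_up (s r : R) : 0 < r -> r <= s ->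
  `|u s - u r| <= v r * (s / r - 1).
Proof.
move=> r0 rs; have [|c rcs ->] := mean_value rs (df := du) (f := u).
  by move=> x ?; apply: du_u; lra.
have c0 : 0 < c by lra.
have rc : r <= c by lra.
have dc : `|du c| <= v r / r.
  apply: le_trans (div_id_nonincreasing r0 rc).
  by rewrite ler_pdivlMr// mulrC du_le.
rewrite normrM (ger0_norm (_ : 0 <= s - r)) ?subr_ge0//.
have -> : v r * (s / r - 1) = v r / r * (s - r) by field; rewrite gt_eqF.
by rewrite ler_wpM2r// subr_ge0.
Qed.

End Oscillation.

Lemma gronwall0 v (dv : R -> R) (k : R) :
  (forall t : R, 0 <= t <= 1 -> is_derive t 1 v (dv t)) ->
  (forall t : R, 0 <= t <= 1 -> dv t <= k * v t) ->
  v 0 = 0 -> forall t : R, 0 <= t <= 1 -> v t <= 0.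
Proof.
move=> dv_v dv_le v0 t /andP[t0 t1].
have dexp (x : R) :
    is_derive x 1 (fun y : R => expR (- k * y)) (- k * expR (- k * x)).
  have D := fderivM (fderiv_cst (- k) x) (fderiv_id x).
  have := fderiv_comp (g := expR) D (is_derive_expR _).
  by rewrite /= mulr0 addr0 mulr1 mulrC.
suff : - (v 0 * expR (- k * 0)) <= - (v t * expR (- k * t)).
  by rewrite v0 mul0r oppr0 oppr_ge0 pmulr_lle0// expR_gt0.
apply: (nondecreasing_of_derive (u := fun x => - (v x * expR (- k * x)))
  (du := fun x => - (v x * (- k * expR (- k * x)) + expR (- k * x) * dv x)) t0).
  move=> x xt; apply: is_deriveN.
  have dvx : is_derive x 1 v (dv x) by apply: dv_v; lra.
  exact: (@is_deriveM R R^o v _ x 1 _ _ dvx (dexp x)).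
move=> x xt; have {xt} : 0 <= x <= 1 by lra.
move=> /dv_le le1.
have -> : - (v x * (- k * expR (- k * x)) + expR (- k * x) * dv x) =
  expR (- k * x) * (k * v x - dv x) by ring.
by rewrite mulr_ge0 ?expR_ge0// subr_ge0.
Qed.

End RealVariable.

(** * Herglotz functions on lines and on the imaginary axis *)

Section HalfPlane.
Variables (R : realType) (q dq : R[i] -> R[i]).
Hypothesis qd : forall w : R[i], 0 < complex.Im w -> fderiv q w (dq w).
Hypothesis q_ge0 : forall w : R[i], 0 < complex.Im w -> 0 <= complex.Im (q w).

Lemma derivative_le (w : R[i]) : 0 < complex.Im w ->
  complex.Im w * cmod (dq w) <= complex.Im (q w).
Proof.
move=> w0; apply: schwarz_pick => //; last exact: qd.
by move=> w' w'0; exists (dq w'); exact: qd.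
Qed.

Section Line.
Variables (z e : R[i]) (t : R).
Hypothesis t0 : 0 < complex.Im (z + t%:C * e).

Let line_approx : forall eps : R, 0 < eps -> exists2 del : R, 0 < del &
  forall s : R, `|s - t| <= del ->
    cmod (q (z + s%:C * e) - q (z + t%:C * e)
          - dq (z + t%:C * e) * e * (s - t)%:C) <= eps * `|s - t|.
Proof.
move=> eps eps0; have K0 : 0 < cmod e + 1 by rewrite ltr_wpDl// cmod_ge0.
have [|del del0 qP] := is_derive_cdiff (qd t0) (e := eps / (cmod e + 1)).
  by rewrite divr_gt0.
exists (del / (cmod e + 1)) => [|s st]; first by rewrite divr_gt0.
have zE : z + s%:C * e - (z + t%:C * e) = (s - t)%:C * e.
  by rewrite rmorphB /=; ring.
have cE : cmod ((s - t)%:C * e) = `|s - t| * cmod e.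
  by rewrite ComplexField.Normc.normcM cmod_real.
have le1 : `|s - t| * cmod e <= `|s - t| * (cmod e + 1).
  by rewrite ler_wpM2l// lerDl.
have := qP (z + s%:C * e); rewrite zE cE => qs.
rewrite -mulrA (mulrC e) (le_trans (qs _))//.
  by rewrite (le_trans le1)// -ler_pdivlMr.
have -> : eps * `|s - t| = eps / (cmod e + 1) * (`|s - t| * (cmod e + 1)).
  by field; rewrite gt_eqF.
by rewrite ler_pM2l// divr_gt0.
Qed.

Lemma is_derive_line_Im : is_derive t 1
  (fun s : R => complex.Im (q (z + s%:C * e)))
  (complex.Im (dq (z + t%:C * e) * e)).
Proof.
apply: approx_is_derive => eps eps0.
have [del del0 qP] := line_approx eps0; exists del => // s /qP qs.
apply: le_trans qs; apply: le_trans (Im_le_cmod _).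
rewrite !ImB; case: (dq _ * e) => a b /=.
by rewrite mulr0 add0r.
Qed.

Lemma is_derive_line_Re : is_derive t 1
  (fun s : R => complex.Re (q (z + s%:C * e)))
  (complex.Re (dq (z + t%:C * e) * e)).
Proof.
apply: approx_is_derive => eps eps0.
have [del del0 qP] := line_approx eps0; exists del => // s /qP qs.
apply: le_trans qs; apply: le_trans (Re_le_cmod _).
rewrite !ReB; case: (dq _ * e) => a b /=.
by rewrite mulr0 subr0.
Qed.

End Line.

(** Along the segment from z0 to z, Schwarz-Pick gives |d/dt q| <= k Im q with a
    constant k, since Im stays away from 0. By Gronwall's inequality Im q
    remains 0, and then so does the derivative of Re q. *)
Lemma constant_of_Im_eq0 (z0 z : R[i]) : 0 < complex.Im z0 ->
  complex.Im (q z0) = 0 -> 0 < complex.Im z -> q z = (complex.Re (q z0))%:C.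
Proof.
move=> z00 qz0 z1.
pose e : R[i] := z - z0; pose c (t : R) : R[i] := z0 + t%:C * e.
pose m := Num.min (complex.Im z0) (complex.Im z).
have m0 : 0 < m by rewrite lt_min z00.
have cm (t : R) : 0 <= t <= 1 -> m <= complex.Im (c t).
  move=> t01; have -> : complex.Im (c t) =
      (1 - t) * complex.Im z0 + t * complex.Im z.
    by rewrite /c /e; case: (z0) => x0 y0; case: (z) => x y /=; ring.
  have mz0 : m <= complex.Im z0 by rewrite ge_min lexx.
  have mz : m <= complex.Im z by rewrite ge_min lexx orbT.
  have [t0 t1] : 0 <= t /\ 0 <= 1 - t by lra.
  have := ler_wpM2l t1 mz0; have := ler_wpM2l t0 mz; lra.
have c_gt0 (t : R) : 0 <= t <= 1 -> 0 < complex.Im (c t).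
  by move=> /cm; exact: lt_le_trans.
have slope (t : R) : 0 <= t <= 1 ->
    cmod (dq (c t) * e) <= cmod e / m * complex.Im (q (c t)).
  move=> t01; have := derivative_le (c_gt0 t t01) => le1.
  rewrite ComplexField.Normc.normcM mulrC -mulrA ler_wpM2l ?cmod_ge0//.
  rewrite ler_pdivlMl//; apply: le_trans le1.
  by rewrite ler_wpM2r ?cmod_ge0// cm.
have dA (t : R) : 0 <= t <= 1 -> is_derive t 1
    (fun s : R => complex.Im (q (c s))) (complex.Im (dq (c t) * e)).
  by move=> t01; apply: is_derive_line_Im; exact: c_gt0.
have dB (t : R) : 0 <= t <= 1 -> is_derive t 1
    (fun s : R => complex.Re (q (c s))) (complex.Re (dq (c t) * e)).
  by move=> t01; apply: is_derive_line_Re; exact: c_gt0.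
have c0 : c 0 = z0 by rewrite /c mul0r addr0.
have c1 : c 1 = z by rewrite /c mul1r /e addrC subrK.
have A0 (t : R) : 0 <= t <= 1 -> complex.Im (q (c t)) = 0.
  move=> t01; apply/eqP; rewrite eq_le q_ge0 ?c_gt0// andbT.
  apply: (gronwall0 (k := cmod e / m) dA) t01; last by rewrite c0.
  move=> x x01; apply: le_trans (slope x x01).
  by apply: le_trans (Im_le_cmod _); rewrite ler_norm.
have [s s01 BE] := mean_value ler01 dB.
have B0 : complex.Re (dq (c s) * e) = 0.
  have := slope s s01; rewrite A0// mulr0 => le0.
  by apply/eqP; rewrite -normr_le0 (le_trans (Re_le_cmod _)).
move: BE; rewrite B0 mul0r c0 c1 => /subr0_eq BE.
have Az : complex.Im (q z) = 0 by rewrite -c1 A0// lexx ler01.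
by case: (q z) BE Az => a b /= -> ->.
Qed.

Let ray (t : R) : 0 +i* t = 0 + t%:C * 'i%C.
Proof. by simpc. Qed.

Let dray (t : R) := dq (0 +i* t) * 'i%C.

Let dray_le (t : R) : 0 < t -> t * cmod (dray t) <= complex.Im (q (0 +i* t)).
Proof.
move=> t0; rewrite ComplexField.Normc.normcM [cmod 'i%C]/=.
by rewrite expr0n expr1n add0r sqrtr1 mulr1; exact: (@derivative_le (0 +i* t)).
Qed.

Let dIm (t : R) : 0 < t ->
  is_derive t 1 (fun s => complex.Im (q (0 +i* s))) (complex.Im (dray t)).
Proof.
move=> t0; under eq_fun do rewrite ray.
rewrite /dray ray; apply: is_derive_line_Im.
by rewrite -ray.
Qed.

Let dRe (t : R) : 0 < t ->
  is_derive t 1 (fun s => complex.Re (q (0 +i* s))) (complex.Re (dray t)).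
Proof.
move=> t0; under eq_fun do rewrite ray.
rewrite /dray ray; apply: is_derive_line_Re.
by rewrite -ray.
Qed.

Let dIm_le (t : R) : 0 < t ->
  t * `|complex.Im (dray t)| <= complex.Im (q (0 +i* t)).
Proof.
move=> t0; apply: le_trans (dray_le t0).
by rewrite ler_pM2l// Im_le_cmod.
Qed.

Let dRe_le (t : R) : 0 < t ->
  t * `|complex.Re (dray t)| <= complex.Im (q (0 +i* t)).
Proof.
move=> t0; apply: le_trans (dray_le t0).
by rewrite ler_pM2l// Re_le_cmod.
Qed.

Lemma ray_down (s r : R) : 0 < s -> s <= r ->
  cmod (q (0 +i* s) - q (0 +i* r)) <=
    2 * complex.Im (q (0 +i* r)) * (r / s - 1).
Proof.
move=> s0 sr; rewrite (le_trans (cmod_le_ReIm _))// ReB ImB.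
rewrite -mulrA mulr_natl mulr2n lerD//.
- exact: (oscillation_down dIm dRe dIm_le dRe_le).
- exact: (oscillation_down dIm dIm dIm_le dIm_le).
Qed.

Lemma ray_up (s r : R) : 0 < r -> r <= s ->
  cmod (q (0 +i* s) - q (0 +i* r)) <=
    2 * complex.Im (q (0 +i* r)) * (s / r - 1).
Proof.
move=> r0 rs; rewrite (le_trans (cmod_le_ReIm _))// ReB ImB.
rewrite -mulrA mulr_natl mulr2n lerD//.
- exact: (oscillation_up dIm dRe dIm_le dRe_le).
- exact: (oscillation_up dIm dIm dIm_le dIm_le).
Qed.

Lemma continuous_ray (t : R) : 0 < t ->
  {for t, continuous (fun s : R => cmod (q (0 +i* s)))}.
Proof.
move=> t0; have cIm := derive_continuous (dIm t0).
have cRe := derive_continuous (dRe t0).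
have -> : (fun s => cmod (q (0 +i* s))) = (fun s => Num.sqrt
    (complex.Re (q (0 +i* s)) * complex.Re (q (0 +i* s)) +
     complex.Im (q (0 +i* s)) * complex.Im (q (0 +i* s)))).
  by apply/funext => s; case: (q _) => a b; rewrite -!expr2.
by apply: (cvg_comp _ _ (cvgD (cvgM cRe cRe) (cvgM cIm cIm)));
  exact: sqrt_continuous.
Qed.

End HalfPlane.

(** * Limits along the imaginary axis *)

Lemma herglotz_offaxis_eq (R : realType) (q : R[i] -> R[i]) (c : R) :
  herglotz q -> (forall z : R[i], 0 < complex.Im z -> q z = c%:C) ->
  forall z, offaxis z -> q z = c%:C.
Proof.
move=> [_ _ q_conj] qc z zoff.
have [z0|z0|z0] := ltgtP 0 (complex.Im z); first exact: qc.
- rewrite -(conjcK z) q_conj; last first.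
    by move: zoff; rewrite /offaxis /=; case: (z) => a b /=; rewrite oppr_eq0.
  rewrite qc ?conjc_real//.
  by move: z0; case: (z) => a b /=; rewrite oppr_gt0.
- by move: zoff; rewrite /offaxis /= -z0 eqxx.
Qed.

Lemma cvg_complex_bound (R : realType) (f : R -> R[i]) (l : R[i]) (g : R -> R) :
  (\forall r \near +oo, cmod (f r - l) <= g r) ->
  g r @[r --> +oo] --> (0 : R) ->
  (f r : R[i]^o) @[r --> +oo] --> (l : R[i]^o).
Proof.
move=> fg g0; apply/cvgrPdist_le => e e0.
have /complex_realP[s es] : e \is Num.real by exact: gtr0_real.
move: e0; rewrite es ltcR => s0.
move/cvgrPdist_le : g0 => /(_ s s0) g0; near=> r.
rewrite distrC [leLHS](normcE_real (f r - l)) lecR.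
apply: (@le_trans _ _ (g r)); first by near: r.
have : `|0 - g r| <= s by near: r.
by rewrite sub0r normrN => /(le_trans (ler_norm _)).
Unshelve. all: by end_near. Qed.

Lemma cvg_powR0 (R : realType) (f : R -> R) (a : R) : 0 < a ->
  (\forall r \near +oo, 0 <= f r) -> f r @[r --> +oo] --> (0 : R) ->
  f r `^ a @[r --> +oo] --> (0 : R).
Proof.
move=> a0 f_ge0 f0; apply/cvgrPdist_le => e e0.
have ea0 : 0 < e `^ a^-1 by exact: powR_gt0.
move/cvgrPdist_le : f0 => /(_ _ ea0) f0; near=> r.
have fr0 : 0 <= f r by near: r.
have : `|0 - f r| <= e `^ a^-1 by near: r.
rewrite !sub0r !normrN (ger0_norm fr0) (ger0_norm (powR_ge0 _ _)) => fe.
have := ge0_ler_powR (ltW a0) fr0 (ltW ea0) fe.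
by rewrite -powRrM mulVf ?gt_eqF// powRr1// ltW.
Unshelve. all: by end_near. Qed.

Section Ray.
Variables (R : realType) (q : R[i] -> R[i]).
Hypotheses (hq : herglotz q) (q_neq0 : exists2 z, offaxis z & q z != 0).
Let p (r : R) := q (0 +i* r).
Let eps (r : R) := complex.Im (p r) / cmod (p r).
Hypothesis eps0 : eps r @[r --> +oo] --> (0 : R).

Let dq (z : R[i]) : R[i] := 'D_1 (q : R[i]^o -> R[i]^o) (z : R[i]^o).

Let off (z : R[i]) : 0 < complex.Im z -> offaxis z.
Proof. by move=> z0; rewrite /offaxis /= gt_eqF. Qed.

Let qd (z : R[i]) : 0 < complex.Im z -> fderiv q z (dq z).
Proof.
by move=> /off zoff; case: hq => holo _ _; apply: derivableP; exact: holo.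
Qed.

Let q_ge0 (z : R[i]) : 0 < complex.Im z -> 0 <= complex.Im (q z).
Proof.
move=> z0; case: hq => _ /(_ z (off z0)) + _.
by rewrite pmulr_lge0 ?invr_gt0.
Qed.

(* The dichotomy that isolates the degenerate case: eps vanishes somewhere only
   if q is a real constant. *)
Let const_or_Im_gt0 :
  (exists2 c : R, c != 0 & forall z, offaxis z -> q z = c%:C) \/
  (forall z : R[i], 0 < complex.Im z -> 0 < complex.Im (q z)).
Proof.
have [[z0 [z00 qz0]]|no] :=
    pselect (exists z0 : R[i], 0 < complex.Im z0 /\ complex.Im (q z0) = 0).
  left; exists (complex.Re (q z0)).
    have qc := herglotz_offaxis_eq hq
      (fun z => constant_of_Im_eq0 qd q_ge0 z00 qz0 (z := z)).
    by have [z /qc -> +] := q_neq0; rewrite fmorph_eq0.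
  apply: (herglotz_offaxis_eq hq) => z.
  exact: (constant_of_Im_eq0 qd q_ge0 z00 qz0).
right=> z z0; rewrite lt_neqAle q_ge0// andbT eq_sym.
by apply: contra_notN no => /eqP qz; exists z.
Qed.

Let p_neq0 r : 0 < r -> p r != 0.
Proof.
move=> r0; case: const_or_Im_gt0 => [[c c0 qc]|Im_gt0].
  by rewrite /p qc ?fmorph_eq0//; exact: (off (z := 0 +i* r)).
by apply: contraTneq (Im_gt0 (0 +i* r) r0); rewrite /p => ->; rewrite ltxx.
Qed.

Let cmod_gt0 r : 0 < r -> 0 < cmod (p r).
Proof.
move=> /p_neq0 pr; rewrite lt_neqAle cmod_ge0 andbT eq_sym.
by apply: contra_neq pr; exact: ComplexField.Normc.eq0_normc.
Qed.

Let eps_ge0 r : 0 < r -> 0 <= eps r.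
Proof. by move=> r0; rewrite divr_ge0 ?cmod_ge0// (q_ge0 (z := 0 +i* r)). Qed.

Let eps_le1 r : 0 < r -> eps r <= 1.
Proof.
move=> r0; rewrite ler_pdivrMr ?cmod_gt0// mul1r.
by rewrite (le_trans (ler_norm _))// Im_le_cmod.
Qed.

Let ratio_le s r b : 0 < r ->
  cmod (p s - p r) <= 2 * complex.Im (p r) * b ->
  cmod (p s / p r - 1) <= 2 * eps r * b.
Proof.
move=> r0 le1; have pr := p_neq0 r0; have cr := cmod_gt0 r0.
have -> : p s / p r - 1 = (p s - p r) / p r by field.
rewrite ComplexField.Normc.normcM ComplexField.Normc.normcV ler_pdivrMr//.
apply: le_trans le1 _; rewrite le_eqVlt; apply/orP; left.
by rewrite /eps; apply/eqP; field; rewrite gt_eqF.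
Qed.

(** The constant k + 1/k dominates both r/s and s/r for s = k r, which covers
    k <= 1 and k >= 1 together. *)
Lemma ratio_scaled (k : R) : 0 < k ->
  (p (k * r) / p r : R[i]^o) @[r --> +oo] --> (1 : R[i]^o).
Proof.
move=> k0; apply: (cvg_complex_bound (g := fun r => 2 * eps r * (k + k^-1))).
  near=> r; have r0 : 0 < r by near: r; exact: nbhs_pinfty_gt.
  have ki : 0 < k^-1 by rewrite invr_gt0.
  apply: le_trans (_ : _ <= 2 * eps r * (k + k^-1 - 1)) _; last first.
    by apply: ler_wpM2l; [rewrite mulr_ge0 ?eps_ge0|rewrite gerBl].
  apply: ratio_le => //.
  have v0 : 0 <= 2 * complex.Im (p r).
    by rewrite mulr_ge0// (q_ge0 (z := 0 +i* r)).
  have [k1|k1] := leP k 1.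
    have kr : k * r <= r by rewrite ler_piMl// ltW.
    apply: le_trans (ray_down qd q_ge0 (mulr_gt0 k0 r0) kr) _.
    have -> : r / (k * r) = k^-1 by field; rewrite !gt_eqF.
    by rewrite ler_wpM2l// lerD2r lerDr ltW.
  have rk : r <= k * r by rewrite ler_peMl// ltW.
  apply: le_trans (ray_up qd q_ge0 r0 rk) _.
  rewrite mulfK ?gt_eqF//.
  by rewrite ler_wpM2l// lerD2r lerDl ltW.
rewrite -(mul0r (k + k^-1)) -(mulr0 2).
by apply: cvgMl; apply: cvgMr.
Unshelve. all: by end_near. Qed.

(** With s = r eps^delta, eps (r/s - 1) <= eps^(1 - delta). When q is constant,
    s may be 0 and the value of q there is that of [const_ext0]. *)
Lemma ratio_eps (delta : R) : 0 <= delta < 1 ->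
  (const_ext0 q (0 +i* (r * eps r `^ delta)) / p r : R[i]^o)
    @[r --> +oo] --> (1 : R[i]^o).
Proof.
move=> /andP[delta0 delta1]; case: const_or_Im_gt0 => [[c c0 qc]|Im_gt0].
  have qc1 r : 0 < r -> q (0 +i* r) = c%:C.
    by move=> r0; apply: qc; exact: (off (z := 0 +i* r)).
  have ext t : 0 <= t -> const_ext0 q (0 +i* t) = c%:C.
    rewrite le_eqVlt /const_ext0 => /orP[/eqP <-|t0].
      rewrite asboolT ?qc1//; split=> //; exists c => w; exact: qc.
    rewrite asboolF ?qc1// => -[/eqP]; rewrite eq_complex /= => /andP[_].
    by rewrite gt_eqF.
  apply: (cvg_complex_bound (g := cst 0)); last exact: cvg_cst.
  near=> r; have r0 : 0 < r by near: r; exact: nbhs_pinfty_gt.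
  rewrite ext; last by rewrite mulr_ge0 ?powR_ge0// ltW.
  rewrite /p qc1// divff ?fmorph_eq0// subrr.
  by rewrite ComplexField.Normc.normc0.
have d1 : 0 < 1 - delta by rewrite subr_gt0.
apply: (cvg_complex_bound (g := fun r => 2 * eps r `^ (1 - delta))).
  near=> r; have r0 : 0 < r by near: r; exact: nbhs_pinfty_gt.
  have er0 : 0 < eps r by rewrite divr_gt0 ?cmod_gt0// (Im_gt0 (0 +i* r)).
  have ed0 : 0 < eps r `^ delta by exact: powR_gt0.
  have ed1 : eps r `^ delta <= 1.
    apply: (@le_trans _ _ (1 `^ delta)); last by rewrite powR1.
    apply: ge0_ler_powR => //.
    - by rewrite nnegrE ltW.
    - by rewrite nnegrE.
    - exact: eps_le1.
  have s0 : 0 < r * eps r `^ delta by rewrite mulr_gt0.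
  have sr : r * eps r `^ delta <= r by rewrite ler_piMr// ltW.
  have -> : const_ext0 q (0 +i* (r * eps r `^ delta)) = p (r * eps r `^ delta).
    rewrite /const_ext0 asboolF// => -[/eqP]; rewrite eq_complex /= => /andP[_].
    by rewrite gt_eqF.
  have down := ray_down qd q_ge0 s0 sr.
  apply: le_trans (ratio_le r0 down) _.
  have -> : r / (r * eps r `^ delta) = (eps r `^ delta)^-1.
    by field; rewrite !gt_eqF.
  have -> : eps r `^ (1 - delta) = eps r / eps r `^ delta.
    by rewrite powRB ?(gt_eqF er0) ?implybT// powRr1// ltW.
  by rewrite mulrA; apply: ler_wpM2l; [rewrite mulr_ge0// ltW|rewrite gerBl].
have := cvg_powR0 d1 _ eps0 => cv.
rewrite -[X in _ --> X](mulr0 2); apply: cvgMr; apply: cv.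
by near=> r; apply: eps_ge0; near: r; exact: nbhs_pinfty_gt.
Unshelve. all: by end_near. Qed.

Lemma cmod_slowly_varying : slowly_varying (fun r : R => cmod (p r)).
Proof.
split; [|exact: cmod_gt0|].
  apply: open_continuous_measurable_fun; first exact: open_gt.
  by move=> r; rewrite inE => r0; exact: (continuous_ray qd r0).
move=> k k0; apply/cvgrPdist_le => e e0.
have := ratio_scaled k0 => /cvgrPdist_le/(_ e%:C); rewrite ltcR => /(_ e0) lim.
near=> r; have r0 : 0 < r by near: r; exact: nbhs_pinfty_gt.
have : `|1 - p (k * r) / p r| <= e%:C by near: r.
rewrite [leLHS](normcE_real (1 - p (k * r) / p r)) lecR; apply: le_trans.
rewrite -ComplexField.Normc.normcV -ComplexField.Normc.normcM.
have triangle (a b : R[i]) : cmod a - cmod b <= cmod (a - b).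
  by rewrite lerBlDr -[in leLHS](subrK b a) le_normcD.
have t1 := triangle 1 (p (k * r) / p r).
have := triangle (p (k * r) / p r) 1.
rewrite -(normcN (_ - 1)) opprB => t2.
by move: t1 t2; rewrite ComplexField.Normc.normc1 ler_norml; lra.
Unshelve. all: by end_near. Qed.

End Ray.

Unset Implicit Arguments.

Theorem theorem4p3p2 (R : realType) (q : R[i] -> R[i])
    (hq : herglotz q)
    (q_neq0 : exists2 z, offaxis z & q z != 0)
    (hIm : complex.Im (q (0 +i* r)) / cmod (q (0 +i* r)) @[r --> +oo] --> (0 : R)) :
  [/\ forall delta : R, 0 <= delta < 1 ->
        (const_ext0 q
           (0 +i* (r * (complex.Im (q (0 +i* r)) / cmod (q (0 +i* r))) `^ delta))
         / q (0 +i* r) : R[i]^o) @[r --> +oo] --> (1 : R[i]^o),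
      forall k : R, 0 < k ->
        (q (0 +i* (k * r)) / q (0 +i* r) : R[i]^o) @[r --> +oo] --> (1 : R[i]^o) &
      slowly_varying (fun r : R => cmod (q (0 +i* r)))].
Proof.
split.
- exact: ratio_eps.
- exact: ratio_scaled.
- exact: cmod_slowly_varying.
Qed.
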